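(* For every $n\ge0$, the number of $\{h,d\}$-avoiding (i.e. increasing) GNC-trees with $n+1$ vertices equals the $n$th little Schröder number $R_n$; equivalently, there is a bijection between $\mathsf{GNC}_n(h,d)$ and the set $\mathscr{R}_n$ of little Schröder paths of length $2n$.
   Context: A non-crossing tree on $n+1$ points: place $n+1$ points $p_0,\dots,p_n$ on a circle in counterclockwise order and draw a tree on them with straight edges inside the circle, no two crossing. A (rooted) GNC-tree with $n+1$ vertices is such a tree with a labelling of the points by positive integers, weakly increasing along $p_0,\dots,p_n$, $p_0$ labelled 1, label set $\{1,\dots,m\}$ for some $m$; rooted at $p_0$. Orient each edge from parent (closer to root) to child; it is an ascent if parent label $<$ child label, a level if equal, a descent if larger. $\mathsf{GNC}_n(h,d)$ is the set of such trees with $n+1$ vertices having no level and no descent edge. A little Schröder path of length $2n$ is a lattice path in the first quadrant from $(0,0)$ to $(2n,0)$ with steps $U=(1,1)$, $D=(1,-1)$ and horizontal steps $(2,0)$, with no horizontal step on the $x$-axis. $R_n=|\mathscr{R}_n|$, with generating function $\sum_n R_nt^n=\frac{1+t-\sqrt{1-6t+t^2}}{4t}$. *)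

(* Defs.v *)
From HB Require Import structures.
From mathcomp Require Import all_boot all_order all_algebra.

Set Implicit Arguments.
Unset Strict Implicit.
Unset Printing Implicit Defensive.

(* The points p_0, ..., p_n are the elements of 'I_n.+1, in counterclockwise
   order; a drawing is its set of edges, an edge being a pair of points. *)
Section NonCrossingTrees.

Variables (n : nat) (E : {set {set 'I_n.+1}}).

Definition edges_ok : bool := [forall (e | e \in E), #|e| == 2].

Definition adj : rel 'I_n.+1 := [rel x y | (x != y) && ([set x; y] \in E)].

Definition is_connected : bool := [forall x, forall y, connect adj x y].

(* A cycle without repeated vertices has at most n+1 vertices, so bounding
   its length loses nothing. *)
Definition is_acyclic : bool :=
  [forall k : 'I_n.+2, forall c : k.-tuple 'I_n.+1,
     (2 < k) ==> ~~ ucycleb adj c].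

Definition is_tree : bool := [&& edges_ok, is_connected & is_acyclic].

(* Two chords of a circle meet in an interior point that is not a common
   endpoint iff their endpoints are distinct and interlace along the circle. *)
Definition non_crossing : bool :=
  [forall i : 'I_n.+1, forall j : 'I_n.+1,
   forall k : 'I_n.+1, forall l : 'I_n.+1,
     [&& i < j, j < k & k < l] ==> ~~ (adj i k && adj j l)].

(* Distance from the root p_0: the least k such that some walk with k edges
   leads from p_0 to y (its value is n+1 if y is not reachable). *)
Definition depth (y : 'I_n.+1) : nat :=
  find (fun k => [exists s : k.-tuple 'I_n.+1,
                    path adj ord0 s && (last ord0 s == y)])
       (iota 0 n.+1).

Definition parent : rel 'I_n.+1 := [rel x y | adj x y && (depth x < depth y)].

End NonCrossingTrees.

(* A labelling by positive integers with label set {1, ..., m} of n+1 points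
   has m <= n+1 (see label_bound), so labels are taken in 'I_n.+2. *)
Definition is_gnc_labelling n (l : {ffun 'I_n.+1 -> 'I_n.+2}) : bool :=
  [&& [forall i : 'I_n.+1, forall j : 'I_n.+1, (i <= j) ==> (l i <= l j)],
      (l ord0 == 1 :> nat)
    & [exists m : 'I_n.+2,
         [set l i | i : 'I_n.+1] == [set k : 'I_n.+2 | 0 < k <= m]]].

Lemma label_bound n (l : 'I_n.+1 -> nat) (m : nat) :
  (forall k, (exists i, l i = k) <-> 0 < k <= m) -> forall i, l i < n.+2.
Proof.
move=> Hm i; have /andP[_ lim] := (Hm (l i)).1 (ex_intro _ i erefl).
rewrite ltnS (leq_trans lim) // -(size_iota 1 m).
have /uniq_leq_size : uniq (iota 1 m) by exact: iota_uniq.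
move=> /(_ (codom l)); rewrite size_codom card_ord; apply=> k.
by rewrite mem_iota add1n ltnS => /(Hm k).2 [j <-]; apply: codom_f.
Qed.

Definition gnc_data n : finType :=
  ({set {set 'I_n.+1}} * {ffun 'I_n.+1 -> 'I_n.+2})%type.

Definition is_gnc_tree n (T : gnc_data n) : bool :=
  [&& is_tree T.1, non_crossing T.1 & is_gnc_labelling T.2].

Definition ascent n (T : gnc_data n) : rel 'I_n.+1 :=
  [rel x y | parent T.1 x y && (T.2 x < T.2 y)].
Definition level n (T : gnc_data n) : rel 'I_n.+1 :=
  [rel x y | parent T.1 x y && (T.2 x == T.2 y)].
Definition descent n (T : gnc_data n) : rel 'I_n.+1 :=
  [rel x y | parent T.1 x y && (T.2 x > T.2 y)].

Definition GNC_hd n : {set gnc_data n} :=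
  [set T | [&& is_gnc_tree T,
               [forall x, forall y, ~~ level T x y]
             & [forall x, forall y, ~~ descent T x y]]].

Variant step := U | D | H.

Definition step_code (s : step) : 'I_3 :=
  match s with U => inord 0 | D => inord 1 | H => inord 2 end.
Definition step_decode (i : 'I_3) : step :=
  match val i with 0 => U | 1 => D | _ => H end.
Lemma step_codeK : cancel step_code step_decode.
Proof. by case; rewrite /step_decode /= inordK. Qed.

HB.instance Definition _ := Finite.copy step (can_type step_codeK).

Import GRing.Theory Num.Theory.
Local Open Scope ring_scope.

Definition step_vec (s : step) : int * int :=
  match s with U => (1, 1) | D => (1, -1) | H => (2, 0) end.

Definition endpoint (s : seq step) : int * int := \sum_(a <- s) step_vec a.

Definition is_little_schroder n (s : seq step) : bool :=
  [&& endpoint s == (n.*2%:Z, 0),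
      [forall k : 'I_(size s).+1,
         (0 <= (endpoint (take k s)).1) && (0 <= (endpoint (take k s)).2)]
    & [forall k : 'I_(size s),
         (nth U s k == H) ==> ((endpoint (take k s)).2 != 0)]].

(* Each step moves at least one unit to the right, so a path of length 2n has
   at most 2n steps: bounding the number of steps loses nothing. *)
Lemma little_schroder_size n s : is_little_schroder n s -> (size s <= n.*2)%N.
Proof.
case/and3P=> /eqP E _ _; suff: (size s)%:Z <= (endpoint s).1 by rewrite E.
elim: s {E} => [|a s IH]; first by rewrite /endpoint big_nil.
rewrite /endpoint big_cons /= -addn1 PoszD addrC lerD //.
by case: a.
Qed.

Definition little_schroder_paths n : {set n.*2.-bseq step} :=
  [set p : n.*2.-bseq step | is_little_schroder n p].

Definition little_schroder_number n : nat := #|little_schroder_paths n|.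

(* Main.v *)
(* Since labels weakly increase along the points, a tree without levels and
   descents has each parent placed before its children, so p_0, ..., p_n is the
   preorder of a plane tree, which is determined by its depths d_0, ..., d_n
   (d_0 = 0, 1 <= d_(i+1) <= d_i + 1). The labelling is determined by the set of
   i at which the label jumps, and every edge is an ascent iff there is a jump
   at each i with d_(i+1) = d_i + 1. On the other side, after its k-th non-D
   step a little Schroder path is at some height d_k >= 1, and
   d_(k+1) <= d_k + 1 if that step is U, d_(k+1) <= d_k if it is H; the D steps
   fill in. Both objects are thus coded by the same sequences of pairs
   (depth, jump) = (height, is U). *)
Require Import Defs.
From HB Require Import structures.
From mathcomp Require Import all_boot all_order all_algebra.
From mathcomp Require Import zify.

Set Implicit Arguments.
Unset Strict Implicit.
Unset Printing Implicit Defensive.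

(** * Codes and the height recursion for paths *)

(** The flag that bounds the rise is that of the later entry. From the initial height 0 this forces
    [(1, true)] as first entry, that is, an initial [U]. *)
Definition code_rel (p q : nat * bool) : bool := 0 < q.1 <= p.1 + q.2.

Definition is_code (n : nat) (w : seq (nat * bool)) : bool :=
  (size w == n) && path code_rel (0, true) w.

Definition not_down (a : step) : bool := if a is D then false else true.

(** The little Schröder condition relative to a start at height [h], in a form suited to induction
    on the path. *)
Fixpoint schroder_from (h : nat) (s : seq step) : bool :=
  match s with
  | [::] => h == 0
  | U :: t => schroder_from h.+1 t
  | D :: t => (0 < h) && schroder_from h.-1 t
  | H :: t => (0 < h) && schroder_from h t
  end.

Fixpoint decode (h : nat) (s : seq step) : seq (nat * bool) :=
  match s with
  | [::] => [::]
  | U :: t => (h.+1, true) :: decode h.+1 t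
  | D :: t => decode h.-1 t
  | H :: t => (h, false) :: decode h t
  end.

(** [U] reaches height [d] from [d - 1] and [H] from [d], so the run of [D] before it has length
    [h + b - d]; the last run goes down to the axis. *)
Fixpoint encode (h : nat) (w : seq (nat * bool)) : seq step :=
  match w with
  | [::] => nseq h D
  | (d, b) :: v => nseq (h + b - d) D ++ (if b then U else H) :: encode d v
  end.

Lemma code_path_weaken h h' b b' w :
  h <= h' -> path code_rel (h, b) w -> path code_rel (h', b') w.
Proof.
case: w => //= -[d c] w hh /andP[/andP[/= d0 dh] ->].
by rewrite andbT /code_rel /= d0 (leq_trans dh) // leq_add2r.
Qed.

Lemma decode_code h b s : schroder_from h s -> path code_rel (h, b) (decode h s).
Proof.
elim: s h b => [|[] s IH] h b //=.
- by move=> /IH ->; rewrite /code_rel /= addn1 leqnn.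
- by move=> /andP[_ /(IH _ b)]; apply: code_path_weaken; rewrite leq_pred.
- by move=> /andP[h0 /IH ->]; rewrite /code_rel /= addn0 h0 leqnn.
Qed.

(** One more unit of height lengthens only the first run of [D]; the code condition keeps its length
    from being truncated. *)
Lemma encodeS h b w :
  path code_rel (h, b) w -> encode h.+1 w = D :: encode h w.
Proof.
case: w => [|[d c] w] //= /andP[/andP[/= _ dh] _].
by rewrite addSn subSn.
Qed.

Lemma decodeK h s : schroder_from h s -> encode h (decode h s) = s.
Proof.
elim: s h => [|[] s IH] h /=; first by move/eqP->.
- by move=> /IH ->; rewrite addn1 subnn.
- case: h => //= h hs; rewrite (@encodeS _ true) ?IH //.
  exact: decode_code.
- by move=> /andP[_ /IH ->]; rewrite addn0 subnn.
Qed.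

Lemma size_decode h s : size (decode h s) = count not_down s.
Proof. by elim: s h => [|[] s IH] h //=; rewrite IH. Qed.

Lemma schroder_from_cat_nseq h k s :
  k <= h -> schroder_from h (nseq k D ++ s) = schroder_from (h - k) s.
Proof.
elim: k h => [|k IH] h kh /=; first by rewrite subn0.
by case: h kh => // h kh /=; rewrite IH.
Qed.

Lemma decode_cat_nseq h k s :
  decode h (nseq k D ++ s) = decode (h - k) s.
Proof.
elim: k h => [|k IH] h /=; first by rewrite subn0.
by rewrite IH; congr decode; lia.
Qed.

Lemma encodeK h b w : path code_rel (h, b) w ->
  schroder_from h (encode h w) /\ decode h (encode h w) = w.
Proof.
elim: w h b => [|[d c] w IH] h b /=.
  by rewrite -[nseq h D]cats0 schroder_from_cat_nseq // decode_cat_nseq subnn.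
case/andP=> /andP[/= d0 dh] /IH[sch dec].
(* The run is no longer than [h] because [d >= 1 >= c]. *)
rewrite schroder_from_cat_nseq; last by case: c dh {IH}; lia.
rewrite decode_cat_nseq; case: c dh => /= dh.
  have -> : (h - (h + 1 - d)).+1 = d by lia.
  by rewrite dec sch.
have -> : h - (h + 0 - d) = d by lia.
by rewrite d0 dec sch.
Qed.

(** * Paths in coordinates *)

Section Endpoints.

Import GRing.Theory Num.Theory.
Local Open Scope ring_scope.

Lemma endpoint_cons a s : endpoint (a :: s) = step_vec a + endpoint s.
Proof. by rewrite /endpoint big_cons. Qed.

Lemma endpoint_nil : endpoint [::] = 0.
Proof. by rewrite /endpoint big_nil. Qed.

Lemma endpoint1_ge0 s : 0 <= (endpoint s).1.
Proof.
elim: s => [|a s IH]; first by rewrite endpoint_nil.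
by rewrite endpoint_cons /= addr_ge0 //; case: a.
Qed.

(** A path from height [h] to the axis has [h] more [D] than [U], and [H] has width 2. *)
Lemma schroder_from_endpoint1 h s : schroder_from h s ->
  (endpoint s).1 = (count not_down s).*2%:Z + h%:Z.
Proof.
elim: s h => [|[] s IH] h /=; first by move/eqP->; rewrite endpoint_nil.
- by move/IH; rewrite endpoint_cons /=; lia.
- by move=> /andP[h0 /IH]; rewrite endpoint_cons /=; lia.
- by move=> /andP[h0 /IH]; rewrite endpoint_cons /=; lia.
Qed.

Lemma schroder_fromP h s :
  reflect
    [/\ h%:Z + (endpoint s).2 = 0,
        forall k, (k <= size s)%N -> 0 <= h%:Z + (endpoint (take k s)).2
      & forall k, (k < size s)%N -> nth U s k = H ->
          h%:Z + (endpoint (take k s)).2 != 0]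
    (schroder_from h s).
Proof.
apply: (iffP idP).
  elim: s h => [|a s IH] h.
    move=> /eqP -> ; split => // [|[|k] //=]; by rewrite endpoint_nil.
  case: a => /=.
  - move=> /IH[e0 nn fl]; split.
    + by rewrite endpoint_cons /=; lia.
    + case=> [|k] /= ks; first by rewrite endpoint_nil /=; lia.
      by have := nn k ks; rewrite endpoint_cons /=; lia.
    + case=> [|k] //= ks nk.
      by have := fl k ks nk; rewrite endpoint_cons /=; lia.
  - move=> /andP[h0 /IH[e0 nn fl]]; split.
    + by rewrite endpoint_cons /=; lia.
    + case=> [|k] /= ks; first by rewrite endpoint_nil /=; lia.
      by have := nn k ks; rewrite endpoint_cons /=; lia.
    + case=> [|k] //= ks nk.
      by have := fl k ks nk; rewrite endpoint_cons /=; lia.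
  - move=> /andP[h0 /IH[e0 nn fl]]; split.
    + by rewrite endpoint_cons /=; lia.
    + case=> [|k] /= ks; first by rewrite endpoint_nil /=; lia.
      by have := nn k ks; rewrite endpoint_cons /=; lia.
    + case=> [|k] //= ks nk; first by rewrite endpoint_nil /=; lia.
      by have := fl k ks nk; rewrite endpoint_cons /=; lia.
elim: s h => [|a s IH] h [e0 nn fl].
  by move: e0; rewrite endpoint_nil /= addr0 => -[->].
(* The first step is absorbed into the starting height, so the condition at [k.+1] becomes that of
   the tail at [k]. *)
have tl (h' : nat) : h'%:Z = h%:Z + (step_vec a).2 -> schroder_from h' s.
  move=> eh; apply: IH; split.
  - by move: e0; rewrite endpoint_cons /= eh; lia.
  - by move=> k ks; have := nn k.+1 ks; rewrite /= endpoint_cons /= eh; lia.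
  - move=> k ks nk.
    by have := fl k.+1 ks nk; rewrite /= endpoint_cons /= eh; lia.
case: a e0 nn fl tl => /= e0 nn fl tl.
- by apply: tl; lia.
(* The prefix of length 1 gives [0 < h] before [D]; below, the prefix of length 0 gives it before
   [H]. *)
- have := nn 1%N isT; rewrite /= take0 endpoint_cons endpoint_nil /= => h1.
  by rewrite tl ?andbT; lia.
- have := fl 0%N isT erefl; rewrite endpoint_nil /= => h1.
  by rewrite tl ?andbT; lia.
Qed.

(** By [schroder_from_endpoint1], width [2n] means exactly [n] non-[D] steps; this matches the
    length of a code. *)
Lemma little_schroderE n s :
  is_little_schroder n s = schroder_from 0 s && (count not_down s == n).
Proof.
apply/idP/idP.
  case/and3P=> /eqP E0 /forallP nn /forallP fl.
  have sch : schroder_from 0 s.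
    apply/schroder_fromP; split; first by rewrite E0.
      move=> k ks; rewrite add0r.
      by have /andP[_] := nn (Ordinal (ks : (k < (size s).+1)%N)).
    move=> k ks nk; rewrite add0r.
    by have := fl (Ordinal ks); rewrite /= nk eqxx.
  rewrite sch /=; have := schroder_from_endpoint1 sch.
  by rewrite E0 /= => ?; lia.
case/andP=> sch /eqP cn; have e1 := schroder_from_endpoint1 sch.
have /schroder_fromP[e2 nn fl] := sch.
apply/and3P; split.
- by rewrite -pair_eqE /= e1 cn -[_.2]add0r e2 addr0 !eqxx.
- apply/forallP=> k; rewrite endpoint1_ge0 /= -[_.2]add0r.
  by apply: nn; rewrite -ltnS.
- by apply/forallP=> k; apply/implyP=> /eqP nk; rewrite -[_.2]add0r fl.
Qed.


End Endpoints.

(** * Counting through a common code *)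

(** The two lists of codes are duplicate-free with the same members, hence permutations of each
    other. *)
Lemma eq_card_by_code (T T' : finType) (W : eqType) (f : T -> W)
    (g : T' -> W) (A : {set T}) (B : {set T'}) :
  {in A &, injective f} -> {in B &, injective g} ->
  (forall w, (exists2 x, x \in A & f x = w) <-> (exists2 y, y \in B & g y = w)) ->
  #|A| = #|B|.
Proof.
move=> injf injg AB.
rewrite !cardE -(size_map f) -(size_map g); apply/perm_size/uniq_perm.
- by rewrite map_inj_in_uniq ?enum_uniq // => x y;
     rewrite !mem_enum; apply: injf.
- by rewrite map_inj_in_uniq ?enum_uniq // => x y;
     rewrite !mem_enum; apply: injg.
move=> w; apply/mapP/mapP => -[x]; rewrite mem_enum => xA ew.
  have /AB[y yB <-] : exists2 x, x \in A & f x = w by exists x.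
  by exists y; rewrite ?mem_enum.
have /AB[y yB <-] : exists2 y, y \in B & g y = w by exists x.
by exists y; rewrite ?mem_enum.
Qed.

Lemma little_schroder_code_inj n :
  {in little_schroder_paths n &, injective (decode 0 \o val)}.
Proof.
move=> p q; rewrite !inE !little_schroderE => /andP[sp _] /andP[sq _] /= e.
by apply: val_inj; rewrite /= -(decodeK sp) e decodeK.
Qed.

Lemma little_schroder_code_image n w :
  is_code n w <->
  exists2 p, p \in little_schroder_paths n & decode 0 (val p) = w.
Proof.
split=> [/andP[/eqP sw pw]|[p]].
  have [sch dec] := encodeK pw.
  have lsw : is_little_schroder n (encode 0 w).
    by rewrite little_schroderE sch -(size_decode 0) dec sw eqxx.
  by exists (Bseq (little_schroder_size lsw)); rewrite ?inE.
rewrite inE little_schroderE => /andP[sp cp] <-.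
by rewrite /is_code size_decode cp decode_code.
Qed.

(** * Distance from the root *)

Section Depth.

Variables (n : nat) (E : {set {set 'I_n.+1}}).
Implicit Types (x y z : 'I_n.+1) (s : seq 'I_n.+1).

Lemma adj_sym : symmetric (adj E).
Proof. by move=> x y; rewrite /adj /= eq_sym setUC. Qed.

Lemma depth_le_path s y :
  path (adj E) ord0 s -> last ord0 s = y -> depth E y <= size s.
Proof.
move=> ps ls; rewrite leqNgt; apply/negP => lt.
have := before_find 0 lt.
have sn : size s < n.+1.
  by apply: leq_trans lt _; rewrite -[X in _ <= X](size_iota 0 n.+1) find_size.
rewrite nth_iota // add0n => /existsP[]; exists (in_tuple s).
by rewrite /= ps ls eqxx.
Qed.

Lemma depth_path y : connect (adj E) ord0 y ->
  exists s, [/\ path (adj E) ord0 s, last ord0 s = y & size s = depth E y].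
Proof.
case/connectP=> s0 /shortenP[s ps us _ ly].
have sn : size s < n.+1.
  by have := uniq_leq_size us (fun z _ => mem_enum _ z); rewrite size_enum_ord.
have dn : depth E y < n.+1.
  by apply: leq_trans sn; rewrite ltnS depth_le_path.
have hf : has (fun k => [exists t : k.-tuple 'I_n.+1,
   path (adj E) ord0 t && (last ord0 t == y)]) (iota 0 n.+1).
  by rewrite has_find size_iota.
have := nth_find 0 hf; rewrite -/(depth E y) nth_iota // add0n.
by case/existsP=> t /andP[pt /eqP lt]; exists t; rewrite size_tuple.
Qed.

Lemma depth0 : depth E ord0 = 0.
Proof. by apply/eqP; rewrite -leqn0; apply: (@depth_le_path [::]). Qed.

Hypothesis conn : is_connected E.

Lemma connected x y : connect (adj E) x y.
Proof. by move/forallP: conn => /(_ x)/forallP. Qed.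

Lemma depth_adj x y : adj E x y -> depth E y <= (depth E x).+1.
Proof.
move=> xy; have [s [ps ls <-]] := depth_path (connected ord0 x).
rewrite -(size_rcons s y); apply: depth_le_path; rewrite ?last_rcons //.
by rewrite rcons_path ps ls.
Qed.

(** Take the last edge of a shortest walk: the walk without it bounds the depth of [x] from above,
    [depth_adj] from below. *)
Lemma depth_parent y : y != ord0 ->
  exists2 x, adj E x y & depth E y = (depth E x).+1.
Proof.
move=> y0; have [s [ps ls ds]] := depth_path (connected ord0 y).
case/lastP: s ps ls ds => [_ e|s z]; first by rewrite -e eqxx in y0.
rewrite rcons_path last_rcons size_rcons => /andP[ps sz] zy ds.
rewrite zy in sz; exists (last ord0 s) => //.
apply/eqP; rewrite eqn_leq depth_adj // -ds ltnS.
exact: depth_le_path.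
Qed.

End Depth.

(** * Increasing non-crossing trees and their depths *)

Section IncreasingTree.

Variables (n : nat) (E : {set {set 'I_n.+1}}).
Implicit Types (x y z : 'I_n.+1).
Hypotheses (treeE : is_tree E) (ncE : non_crossing E).
Hypothesis incE : forall x y, parent E x y -> x < y.

Let conn : is_connected E. Proof. by case/and3P: treeE. Qed.

Lemma lower_parent y : y != ord0 ->
  exists x, [/\ adj E x y, x < y & depth E y = (depth E x).+1].
Proof.
move=> /(depth_parent conn)[x xy dy]; exists x; split=> //.
by apply: incE; apply/andP; split; rewrite // dy.
Qed.

(** Parents have ever smaller indices, so the way from [x] to the root stays below [y]. *)
Lemma lower_connect y x : x < y ->
  connect [rel a b | [&& adj E a b, a < y & b < y]] x ord0.
Proof.
elim/ltn_ind: {x}(x : nat) {-2}x (erefl (x : nat)) => k IH x xk xy.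
have [->|x0] := eqVneq x ord0; first exact: connect0.
have [z [zx ltzx _]] := lower_parent x0.
apply: (@connect_trans _ _ z).
  by apply: connect1; apply/and3P; split; rewrite 1?adj_sym // (ltn_trans ltzx).
by apply: (IH z) => //; [rewrite -xk|apply: ltn_trans xy].
Qed.

(* Two lower neighbours of [y] are joined below [y], which closes a cycle. *)
Lemma lower_neighbour_uniq a b y :
  adj E a y -> adj E b y -> a < y -> b < y -> a = b.
Proof.
move=> ay bY lay lby; apply/eqP/negPn/negP => ab.
pose r := [rel a b | [&& adj E a b, a < y & b < y]].
have rs : connect_sym r.
  by apply: sym_connect_sym => u v; apply/and3P/and3P=> -[uv ? ?]; split;
    rewrite 1?adj_sym.
have : connect r a b.
  apply: connect_trans (lower_connect lay) _.
  by rewrite rs lower_connect.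
case/connectP=> q /shortenP[p pp up _ lb].
have pE : path (adj E) a p by apply: sub_path pp => u v /and3P[].
have py : all (fun u : 'I_n.+1 => u < y) p.
  elim: p a pp {lb pE up ay lay ab q} => //= v p IHp a /andP[/and3P[_ _ ->]].
  exact: IHp.
have p0 : 0 < size p by case: p lb ab {pp up pE py} => //= ->; rewrite eqxx.
have uc : ucycleb (adj E) (y :: a :: p).
  rewrite /ucycleb [cycle _ _]/= rcons_path -lb pE bY adj_sym ay.
  rewrite cons_uniq up andbT inE negb_or -val_eqE gtn_eqF //=.
  by rewrite andbT; apply/negP=> yp; have /allP/(_ _ yp) := py; rewrite ltnn.
have sz : size (y :: a :: p) < n.+2.
  have /andP[_ /uniq_leq_size/(_ (fun z _ => mem_enum _ z))] := uc.
  by rewrite size_enum_ord.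
case/and3P: treeE => _ _ /forallP/(_ (Ordinal sz))/forallP/(_ (in_tuple _)).
by rewrite uc /= !ltnS p0.
Qed.

Lemma depth_lower x y : adj E x y -> x < y -> depth E y = (depth E x).+1.
Proof.
move=> xy lxy; have y0 : y != ord0.
  by apply: contraTneq lxy => ->; rewrite ltn0.
have [z [zy lzy ->]] := lower_parent y0.
by rewrite (lower_neighbour_uniq xy zy lxy lzy).
Qed.

(** Induction on [z] through its parent [a]: [a < x] is impossible because the chords [a z] and
    [x y] would cross. *)
Lemma depth_between x y z :
  adj E x y -> x < z -> z < y -> depth E x < depth E z.
Proof.
move=> xy; elim/ltn_ind: {z}(z : nat) {-2}z (erefl (z : nat)) => k IH z zk xz zy.
have z0 : z != ord0 by apply: contraTneq xz => ->; rewrite ltn0.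
have [a [az laz dz]] := lower_parent z0; rewrite dz ltnS.
case: (ltngtP x a) => [xa|ax|/val_inj -> //].
  by apply/ltnW/(IH a) => //; [rewrite -zk|apply: ltn_trans zy].
move/forallP: ncE => /(_ a)/forallP/(_ x)/forallP/(_ z)/forallP/(_ y).
by rewrite ax xz zy az xy.
Qed.

(** Recovers the edges from the depths: the parent of [y] is the last earlier point shallower than
    [y]. *)
Lemma adj_depth x y : x < y ->
  adj E x y = [forall k : 'I_n.+1, (x < k < y) ==> (depth E y <= depth E k)]
              && (depth E x < depth E y).
Proof.
move=> lxy; apply/idP/andP => [xy|[/forallP dk dxy]].
  have dy := depth_lower xy lxy; rewrite dy ltnSn; split=> //.
  apply/forallP=> k; apply/implyP=> /andP[xk ky].
  exact: depth_between xy xk ky.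
have y0 : y != ord0 by apply: contraTneq lxy => ->; rewrite ltn0.
have [z [zy lzy dy]] := lower_parent y0.
(* The true parent [z] is shallower than [y], so it cannot lie between [x] and [y]; if [z < x], the
   chord [z y] makes [x] at least as deep as [y]. *)
case: (ltngtP x z) => [xz|zx|/val_inj -> //].
  by have := dk z; rewrite xz lzy dy ltnn.
by have := depth_between zy zx lxy; rewrite -dy leqNgt dxy.
Qed.

End IncreasingTree.

(** * Labellings and their jumps *)

Section Labelling.

Variables (n : nat) (l : {ffun 'I_n.+1 -> 'I_n.+2}).
Hypothesis lab : is_gnc_labelling l.

Lemma gnc_labelling0 : l ord0 = 1 :> nat.
Proof. by case/and3P: lab => _ /eqP. Qed.

Lemma gnc_labelling_mono (i j : 'I_n.+1) : i <= j -> l i <= l j.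
Proof.
by case/and3P: lab => /forallP/(_ i)/forallP/(_ j)/implyP lm _ _ /lm.
Qed.

(** The labels fill an interval, so consecutive labels differ by 0 or 1, and the jumps determine the
    labelling. *)
Lemma gnc_labelling_succ (i j : 'I_n.+1) : j = i.+1 :> nat ->
  l j = l i + (l i < l j) :> nat.
Proof.
move=> ji; have lij : l i <= l j by apply: gnc_labelling_mono; rewrite ji.
case: ltnP => [lt|le]; last by rewrite addn0; apply/eqP; rewrite eqn_leq le.
case/and3P: lab => _ _ /existsP[m /eqP/setP lm].
have := lm (l j); rewrite !inE imset_f // => /esym/andP[_ ljm].
rewrite addn1; apply/eqP; rewrite eqn_leq lt andbT leqNgt; apply/negP => lt2.
have k_ok : (l i).+1 < n.+2 by apply: ltn_trans lt2 _.
(* A skipped value [(l i).+1] would label some [k], but [k <= i] gives too small a label and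
   [k >= j] too large a one. *)
have := lm (Ordinal k_ok); rewrite !inE /= (leq_trans lt ljm) => /imsetP[k _].
move/(congr1 val) => /= lk.
have [ki|ik] := leqP k i.
  by have := gnc_labelling_mono ki; rewrite -lk ltnn.
have : j <= k by rewrite ji.
by move/gnc_labelling_mono; rewrite -lk leqNgt lt2.
Qed.

End Labelling.

(** * Codes of increasing trees *)

Lemma GNC_hdP n (T : gnc_data n) :
  reflect [/\ is_tree T.1, non_crossing T.1, is_gnc_labelling T.2
            & forall x y, parent T.1 x y -> T.2 x < T.2 y]
          (T \in GNC_hd n).
Proof.
rewrite inE; apply: (iffP and3P).
  case=> /and3P[tT nT lT] /forallP nl /forallP nd; split=> // x y pxy.
  move/forallP: (nl x) => /(_ y); move/forallP: (nd x) => /(_ y).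
  rewrite /level /descent /= in pxy *; rewrite pxy /=.
  by rewrite -leqNgt leq_eqVlt => /orP[/eqP/val_inj ->|->//]; rewrite eqxx.
case=> tT nT lT asc; split; first exact/and3P.
  apply/forallP=> x; apply/forallP=> y; apply/negP=> /andP[/asc].
  by move=> lt /eqP e; rewrite e ltnn in lt.
apply/forallP=> x; apply/forallP=> y; apply/negP=> /andP[/asc].
by move=> lt /(ltn_trans lt); rewrite ltnn.
Qed.

(** Entry [i] describes the point [i.+1]; the root is omitted, its depth 0 and label 1 being
    fixed. *)
Definition tree_code n (T : gnc_data n) : seq (nat * bool) :=
  mkseq (fun i => (depth T.1 (inord i.+1), T.2 (inord i) < T.2 (inord i.+1))) n.

Lemma GNC_hd_increasing n (T : gnc_data n) x y :
  T \in GNC_hd n -> parent T.1 x y -> x < y.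
Proof.
case/GNC_hdP=> _ _ lT asc /asc; rewrite !ltnNge; apply: contra.
exact: gnc_labelling_mono.
Qed.

Lemma tree_codeP n (T : gnc_data n) : T \in GNC_hd n -> is_code n (tree_code T).
Proof.
move=> TG; have incT x y := @GNC_hd_increasing n T x y TG.
case/GNC_hdP: TG => tT nT lT asc.
rewrite /is_code size_mkseq eqxx; apply/(pathP (0, true)) => i.
rewrite size_mkseq => ltin.
(* With the initial entry in front, position [i] belongs to the point [i], which is the root for
   [i = 0]. *)
have -> : nth (0, true) ((0, true) :: tree_code T) i =
    (depth T.1 (inord i), (nth (0, true) ((0, true) :: tree_code T) i).2).
  case: i ltin => [|i] ltin /=.
    by rewrite (_ : inord 0 = ord0) ?depth0 //; apply/val_inj; rewrite /= inordK.
  by rewrite nth_mkseq ?(ltnW ltin).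
rewrite nth_mkseq // /code_rel /=.
set x : 'I_n.+1 := inord i; set y : 'I_n.+1 := inord i.+1.
have xi : x = i :> nat by rewrite inordK // ltnS ltnW.
have yi : y = i.+1 :> nat by rewrite inordK // ltnS.
have y0 : y != ord0 by rewrite -val_eqE /= yi.
have [z [zy lzy dy]] := lower_parent tT incT y0.
(* If the parent [z] of [y] is before [x], then [x] lies under the chord [z y] and is deeper than
   [z]; if [z = x], the edge is an ascent and the flag is true. *)
rewrite dy /=; have [zx|xz|/val_inj e] := ltngtP z x.
- apply: leq_trans (leq_addr _ _); apply: (depth_between tT nT incT zy zx).
  by rewrite xi yi.
- by move: lzy xz; rewrite xi yi ltnS ltnNge => ->.
- rewrite -e asc ?addn1 //; apply/andP; split=> //.
  by rewrite dy.
Qed.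

(** The code gives depths and jumps; the jumps rebuild the labels from the root on, and [adj_depth]
    rebuilds the edges. *)
Lemma tree_code_inj n : {in GNC_hd n &, injective (@tree_code n)}.
Proof.
move=> [E l] [E' l'] TG TG'.
have incE x y := @GNC_hd_increasing n _ x y TG.
have incE' x y := @GNC_hd_increasing n _ x y TG'.
case/GNC_hdP: TG TG' => /= tE nE lE _ /GNC_hdP[/= tE' nE' lE' _] eqc.
have eq_nth (x y : 'I_n.+1) : y = x.+1 :> nat ->
    (depth E y, l x < l y) = (depth E' y, l' x < l' y).
  move=> yx; have xn : x < n by rewrite -ltnS -yx.
  have := congr1 (fun s => nth (0, true) s x) eqc.
  by rewrite !nth_mkseq //= -yx !inord_val.
have eq_ind (P : 'I_n.+1 -> Prop) : P ord0 ->
    (forall x y : 'I_n.+1, y = x.+1 :> nat -> P x -> P y) -> forall x, P x.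
  move=> P0 PS [i]; elim: i => [|i IH] ilt.
    by rewrite (_ : Ordinal ilt = ord0) //; apply: val_inj.
  by apply: (PS (Ordinal (ltnW ilt))) => //; apply: IH.
have eqd x : depth E x = depth E' x.
  elim/eq_ind: x => [|x y yx _]; first by rewrite !depth0.
  by case: (eq_nth x y yx).
have eql : l = l'.
  apply/ffunP=> x; apply: val_inj; elim/eq_ind: x => [|x y yx eqx] /=.
    by rewrite !gnc_labelling0.
  rewrite (gnc_labelling_succ lE yx) (gnc_labelling_succ lE' yx).
  by case: (eq_nth x y yx) => _ ->; congr addn.
have eqadj (x y : 'I_n.+1) : x < y -> adj E x y = adj E' x y.
  move=> xy; rewrite (adj_depth tE nE incE xy) (adj_depth tE' nE' incE' xy).
  rewrite !eqd; congr andb; apply: eq_forallb => k.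
  by rewrite !eqd.
suff -> : E = E' by rewrite eql.
apply/setP=> A; have [cA|cA] := boolP (#|A| == 2); last first.
  by case/and3P: tE tE' => /forallP/(_ A)/implyP eE _ _ /and3P[/forallP/(_ A)/implyP eE' _ _];
    rewrite (negbTE (contra eE cA)) (negbTE (contra eE' cA)).
case/cards2P: cA => x [y [xy ->]].
wlog lxy : x y xy / x < y.
  move=> wl; case: (ltngtP x y) => [|yx|/val_inj e]; first exact: wl.
    by rewrite setUC; apply: wl => //; rewrite eq_sym.
  by rewrite e eqxx in xy.
by have := eqadj x y lxy; rewrite /adj /= xy.
Qed.

(** * The tree of a code *)

Section TreeOfCode.

Variables (n : nat) (d : nat -> nat) (b : nat -> bool).
Hypotheses (d0 : d 0 = 0) (dS : forall i, i < n -> 0 < d i.+1 <= d i + b i).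
Implicit Types (x y z : 'I_n.+1).

(* The parent of [y] is the last point before [y] of smaller depth. *)
Definition depth_parent_rel : rel 'I_n.+1 := [rel x y : 'I_n.+1 |
  [&& x < y, d x < d y
    & [forall k : 'I_n.+1, (x < k < y) ==> (d y <= d k)]]].

Definition tree_of_depth : {set {set 'I_n.+1}} :=
  [set A : {set 'I_n.+1} |
    [exists x, exists y, depth_parent_rel x y && (A == [set x; y])]].

Local Notation par := depth_parent_rel.
Local Notation E := tree_of_depth.

Lemma depth_parent_lt x y : par x y -> x < y.
Proof. by case/and3P. Qed.

Lemma depth_parent_between x y z : par x y -> x < z < y -> d y <= d z.
Proof. by case/and3P=> _ _ /forallP/(_ z)/implyP. Qed.

Lemma adj_tree_of_depth x y : adj E x y = par x y || par y x.
Proof.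
have neq x' y' : par x' y' -> x' != y'.
  by move/depth_parent_lt; apply: contraTneq => ->; rewrite ltnn.
apply/idP/idP => [/andP[xy]|].
  rewrite inE => /existsP[u /existsP[v /andP[uv /eqP/setP e]]].
  have := e x; have := e y; rewrite !inE !eqxx orbT /= => /esym ey /esym ex.
  case/orP: ex => /eqP ex; case/orP: ey => /eqP ey; subst x y;
    by rewrite ?eqxx in xy; rewrite ?uv ?orbT.
case/orP=> pxy; apply/andP; split; try by [exact: neq|rewrite eq_sym neq];
  rewrite inE; apply/existsP.
  by exists x; apply/existsP; exists y; rewrite pxy eqxx.
by exists y; apply/existsP; exists x; rewrite pxy setUC eqxx.
Qed.

Lemma adj_lower x y : adj E x y -> x < y -> par x y.
Proof.
rewrite adj_tree_of_depth => /orP[//|/depth_parent_lt yx] /(ltn_trans yx).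
by rewrite ltnn.
Qed.

Lemma depth_parent_exists y : y != ord0 -> exists x, par x y.
Proof.
move=> y0; have dy : 0 < d y.
  case: y y0 => -[|i] //= ilt _.
  by have /andP[] := dS (ilt : i < n).
pose P := [pred x : 'I_n.+1 | (x < y) && (d x < d y)].
have P0 : P ord0 by rewrite /= lt0n y0 d0.
case: (@arg_maxnP _ ord0 P (@nat_of_ord _) P0) => x /andP[xy dxy] mx.
exists x; apply/and3P; split=> //; apply/forallP=> k; apply/implyP=> /andP[xk ky].
rewrite leqNgt; apply/negP => dk.
by have := mx k; rewrite /= ky dk /geq /= leqNgt xk => /(_ isT).
Qed.

Lemma depth_parent_uniq x z y : par x y -> par z y -> x = z.
Proof.
move=> xy zy; apply: val_inj; case: (ltngtP x z) => // [xz|zx].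
  have := depth_parent_between xy (z := z); rewrite xz (depth_parent_lt zy).
  by case/and3P: zy => _ dz _ /(_ isT); rewrite leqNgt dz.
have := depth_parent_between zy (z := x); rewrite zx (depth_parent_lt xy).
by case/and3P: xy => _ dx _ /(_ isT); rewrite leqNgt dx.
Qed.

(** The point [x.+1] is [y] or lies between [x] and [y], so [d y <= d x.+1 <= d x + b x]; as
    [d x < d y], the jump [b x] must occur. *)
Lemma depth_parent_succ x y : par x y -> d y = (d x).+1 /\ b x.
Proof.
move=> xy; have lxy := depth_parent_lt xy.
have xn : x < n by rewrite -ltnS (leq_ltn_trans lxy).
have /andP[_ dx] := dS xn.
have dyx : d y <= d x.+1.
  have [xSy|yx|<- //] := ltngtP x.+1 y; last by rewrite ltnNge lxy in yx.
  by apply: (depth_parent_between (z := Ordinal (xn : x.+1 < n.+1)) xy); rewrite /= ltnSn.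
have dxy : d x < d y by case/and3P: xy.
by case: (b x) dx => /= dx; split=> //; lia.
Qed.

Lemma tree_of_depth_root y : connect (adj E) y ord0.
Proof.
elim/ltn_ind: {y}(y : nat) {-2}y (erefl (y : nat)) => k IH y yk.
have [->|y0] := eqVneq y ord0; first exact: connect0.
have [x xy] := depth_parent_exists y0.
apply: (@connect_trans _ _ x).
  by apply: connect1; rewrite adj_tree_of_depth xy orbT.
by apply: (IH x) => //; rewrite -yk depth_parent_lt.
Qed.

Lemma tree_of_depth_connected : is_connected E.
Proof.
apply/forallP=> x; apply/forallP=> y.
apply: connect_trans (tree_of_depth_root x) _.
by rewrite sym_connect_sym ?tree_of_depth_root //; apply: adj_sym.
Qed.

(* Both neighbours of the last point of a cycle would be its parent. *)
Lemma tree_of_depth_acyclic : is_acyclic E.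
Proof.
apply/forallP=> k; apply/forallP=> c; apply/implyP=> k2; apply/negP=> uc.
have sc : 2 < size c by rewrite size_tuple.
have x0c : nth ord0 c 0 \in c by rewrite mem_nth // ltnW // ltnW.
case: (@arg_maxnP _ _ [in c] (@nat_of_ord _) x0c) => x xc mx.
have {}mx (z : 'I_n.+1) : z \in c -> z <= x by apply: mx.
have [i s es] := rot_to xc.
have mem_s z : z \in s -> z \in c by rewrite -(mem_rot i c) es inE orbC => ->.
have ucs : ucycle (adj E) (x :: s) by rewrite -es rot_ucycle.
move: sc; rewrite -(size_rot i c) es /=.
(* The neighbours [u] and [v] of the greatest point [x] on the cycle are distinct, the cycle having
   at least three points. *)
case: s es mem_s ucs => [|u s] //= _ mem_s; case/lastP: s mem_s => [|s v] // mem_s.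
rewrite /ucycle /= !rcons_path last_rcons => /andP[/andP[xu /andP[_ vx]]].
case/andP; rewrite inE mem_rcons inE !negb_or => /and3P[nxu nxv _].
case/andP; rewrite mem_rcons inE negb_or => /andP[nuv _] _ _.
have lux : u < x.
  by rewrite ltn_neqAle val_eqE eq_sym nxu; rewrite mx ?mem_s ?mem_head.
have lvx : v < x.
  by rewrite ltn_neqAle val_eqE eq_sym nxv; rewrite mx // mem_s // inE mem_rcons mem_head orbT.
rewrite adj_sym in xu.
by rewrite (depth_parent_uniq (adj_lower xu lux) (adj_lower vx lvx)) eqxx in nuv.
Qed.

Lemma tree_of_depth_tree : is_tree E.
Proof.
apply/and3P; split; [|exact: tree_of_depth_connected|exact: tree_of_depth_acyclic].
apply/forallP=> A; apply/implyP; rewrite inE.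
case/existsP=> x /existsP[y /andP[/depth_parent_lt xy /eqP ->]].
by rewrite cards2 -val_eqE /= (ltn_eqF xy).
Qed.

(** If [i k] and [j l] crossed, then [d l <= d k <= d j], whereas [j] is the parent of [l]. *)
Lemma tree_of_depth_non_crossing : non_crossing E.
Proof.
apply/forallP=> i; apply/forallP=> j; apply/forallP=> k; apply/forallP=> l.
apply/implyP=> /and3P[ij jk kl]; apply/negP=> /andP[ik jl].
have pik := adj_lower ik (ltn_trans ij jk).
have pjl := adj_lower jl (ltn_trans jk kl).
have dkj : d k <= d j by apply: (depth_parent_between pik); rewrite ij.
have dlk : d l <= d k by apply: (depth_parent_between pjl); rewrite jk.
by case/and3P: pjl => _; rewrite ltnNge (leq_trans dlk dkj).
Qed.

(** The chain of parents is a walk with [d y] edges; none is shorter, since an edge raises [d] by at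
    most one. *)
Lemma depth_tree_of_depth y : depth E y = d y.
Proof.
apply/eqP; rewrite eqn_leq; apply/andP; split.
  suff [s [ps ls <-]] : exists s,
      [/\ path (adj E) ord0 s, last ord0 s = y & size s = d y].
    exact: depth_le_path.
  elim/ltn_ind: {y}(y : nat) {-2}y (erefl (y : nat)) => k IH y yk.
  have [->|y0] := eqVneq y ord0; first by exists [::].
  have [x xy] := depth_parent_exists y0.
  have [|s [ps ls ss]] := IH x _ x erefl; first by rewrite -yk depth_parent_lt.
  exists (rcons s y); rewrite rcons_path last_rcons size_rcons ps ls ss.
  by rewrite adj_tree_of_depth xy; case: (depth_parent_succ xy).
have [s [ps ls <-]] := depth_path (connected tree_of_depth_connected ord0 y).
have dpath x t : path (adj E) x t -> d (last x t) <= d x + size t.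
  elim: t x => [|z t IH] x /=; first by rewrite addn0.
  case/andP; rewrite adj_tree_of_depth => xz /IH /leq_trans; apply.
  rewrite addnS -addSn leq_add2r.
  by case/orP: xz => /depth_parent_succ[-> _] //; apply: ltnW.
by have := dpath _ _ ps; rewrite ls d0.
Qed.

Fixpoint jumps_label (i : nat) : nat :=
  if i is j.+1 then jumps_label j + b j else 1.

Lemma jumps_label_bound i : 0 < jumps_label i <= i.+1.
Proof. by elim: i => //= i; case: (b i) => /=; lia. Qed.

Lemma jumps_label_mono i j : i <= j -> jumps_label i <= jumps_label j.
Proof. by move/subnK <-; elim: (j - i) => //= k IH; lia. Qed.

(** A discrete intermediate value argument: labels start at 1 and rise by at most one. *)
Lemma jumps_label_onto j k :
  0 < k <= jumps_label j -> exists2 i, i <= j & jumps_label i = k.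
Proof.
elim: j => [|j IH] kj.
  by exists 0 => //=; move: kj => /=; lia.
have [kj'|] := leqP k (jumps_label j).
  have [|i ij <-] := IH; first by case/andP: kj => ->.
  by exists i => //; apply: leqW.
by exists j.+1 => //; move: kj => /=; case: (b j) => /=; lia.
Qed.

Definition jumps_labelling : {ffun 'I_n.+1 -> 'I_n.+2} :=
  [ffun x : 'I_n.+1 => inord (jumps_label x)].

Lemma jumps_labellingE x : jumps_labelling x = jumps_label x :> nat.
Proof.
rewrite ffunE inordK //; have /andP[_] := jumps_label_bound x.
by have := ltn_ord x; rewrite ltnS; lia.
Qed.

Lemma jumps_labelling_gnc : is_gnc_labelling jumps_labelling.
Proof.
apply/and3P; split; last 1 first.
- apply/existsP; exists (jumps_labelling ord_max); apply/eqP/setP=> k.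
  rewrite inE jumps_labellingE; apply/imsetP/idP => [[x _ ->]|].
    rewrite jumps_labellingE; have /andP[-> _] := jumps_label_bound x.
    by apply: jumps_label_mono; rewrite -ltnS.
  case/jumps_label_onto=> i; rewrite -ltnS => ilt ei.
  by exists (Ordinal ilt) => //; apply: val_inj; rewrite /= jumps_labellingE.
- apply/forallP=> i; apply/forallP=> j; apply/implyP.
  by rewrite !jumps_labellingE; apply: jumps_label_mono.
- by rewrite jumps_labellingE.
Qed.

(** A jump directly follows every parent and labels never fall, so each edge is an ascent. *)
Lemma tree_of_depth_GNC_hd : (E, jumps_labelling) \in GNC_hd n.
Proof.
apply/GNC_hdP; split=> /=.
- exact: tree_of_depth_tree.
- exact: tree_of_depth_non_crossing.
- exact: jumps_labelling_gnc.
move=> x y /andP[]; rewrite !depth_tree_of_depth adj_tree_of_depth => xy dxy.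
have {xy} pxy : par x y.
  by case/orP: xy => // /and3P[_ /(ltn_trans dxy)]; rewrite ltnn.
rewrite !jumps_labellingE.
have := jumps_label_mono (depth_parent_lt pxy).
by apply: leq_trans; rewrite /= (depth_parent_succ pxy).2 addn1.
Qed.

Lemma tree_code_of_depth :
  tree_code (E, jumps_labelling) = mkseq (fun i => (d i.+1, b i)) n.
Proof.
apply: eq_from_nth (0, true) _ _ _ _; rewrite ?size_mkseq // => i ltin.
rewrite !nth_mkseq //= depth_tree_of_depth !jumps_labellingE !inordK //=.
  by congr pair; case: (b i); lia.
by rewrite ltnS ltnW.
Qed.

End TreeOfCode.

(** * The common image and the bijection *)

Lemma tree_code_image n w :
  is_code n w <-> exists2 T, T \in GNC_hd n & tree_code T = w.
Proof.
split=> [/andP[/eqP sw /(pathP (0, true)) pw]|[T /tree_codeP cT <- //]].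
(* [d] reads the list with the root entry in front, [b] the list itself: [b i] is the jump from the
   point [i] to [i.+1]. *)
pose d i := (nth (0, true) ((0, true) :: w) i).1.
pose b i := (nth (0, true) w i).2.
have dS i : i < n -> 0 < d i.+1 <= d i + b i by rewrite -sw => /pw.
exists (tree_of_depth n d, jumps_labelling n b).
  exact: tree_of_depth_GNC_hd.
rewrite (tree_code_of_depth (erefl : d 0 = 0) dS).
rewrite -[RHS](mkseq_nth (0, true)) sw; apply: eq_mkseq => i.
by rewrite /d /b /=; case: (nth _ w i).
Qed.

Theorem theorem2p5 (n : nat) :
  #|GNC_hd n| = little_schroder_number n /\
  exists f : {T : gnc_data n | T \in GNC_hd n} ->
             {p : n.*2.-bseq step | p \in little_schroder_paths n},
    bijective f.
Proof.
have card_eq : #|GNC_hd n| = little_schroder_number n.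
  (* Both codings are injective with image [is_code n]. *)
  apply: (eq_card_by_code (@tree_code_inj n) (@little_schroder_code_inj n)) => w.
  by rewrite -tree_code_image -little_schroder_code_image.
split=> //.
have sig_eq : #|{: {T : gnc_data n | T \in GNC_hd n}}| =
    #|{: {p : n.*2.-bseq step | p \in little_schroder_paths n}}|.
  by rewrite !card_sig card_eq.
(* Elements of equal rank in the two enumerations are matched. *)
exists (fun T => enum_val (cast_ord sig_eq (enum_rank T))).
exists (fun p => enum_val (cast_ord (esym sig_eq) (enum_rank p))) => x.
  by rewrite enum_valK cast_ordK enum_rankK.
by rewrite enum_valK cast_ordKV enum_rankK.
Qed.
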